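(* Let $G$ be a distinguished group, let $A=\{a_1,\dots,a_v\}$ be a simple subgroup of $G$ of order $v$, let $p,q\in G$ and $H_{pq}=(A.p).(A.q)$. Besides $$H_{pq}=\bigcup_{i=1}^{v}(A.p).(a_i.q),$$ there are elements $\tau_1,\dots,\tau_v\in G$ with $\tau_1=p.q$ such that $$H_{pq}=\bigcup_{i=1}^{v}A.\tau_i .$$ If $H_{pq}$ has $v^2$ elements, the sets in each of these two decompositions are pairwise disjoint.
   Context: A distributive group is a nonempty set $G$ with a binary operation $(a,b)\mapsto a.b$ on $G$ such that for all $a,b\in G$ each of the equations $a.x=b$ and $y.a=b$ has exactly one solution in $G$, and for all $a,b,c\in G$, $(a.b).c=(a.c).(b.c)$ and $c.(a.b)=(c.a).(c.b)$. A subgroup of $G$ is a nonempty subset which is itself a distributive group under the restricted operation; the order is the number of elements. A distributive group is simple if it has no proper subgroup of order greater than one. For subsets $X,Y\subseteq G$ and $p\in G$: $X.Y=\{x.y: x\in X,\,y\in Y\}$, $X.p=\{x.p: x\in X\}$, $p.X=\{p.x:x\in X\}$. A finite distributive group $G$ is called distinguished if for every subgroup $B$ of $G$ and every $p\in G$, the sets $B.(B.p)$ and $(B.p).B$ are subgroups of the same order as $B$; equivalently there are $t,\tau\in G$ with $B.(B.p)=B.t$ and $(B.p).B=B.(p.B)=B.\tau$. *)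

(* Defs.v *)
From mathcomp Require Import all_boot.

Set Implicit Arguments.
Unset Strict Implicit.
Unset Printing Implicit Defensive.

Section DistributiveGroups.

Variables (G : finType) (op : G -> G -> G).

(* The axioms are relativized to B, so that the same definition describes
   both the whole group (B = [set: G]) and its subgroups. *)
Record distributive_group_on (B : {set G}) : Prop := {
  dg_nonempty : B != set0;
  dg_closed : forall a b, a \in B -> b \in B -> op a b \in B;
  dg_solve_r : forall a b, a \in B -> b \in B ->
    exists! x, x \in B /\ op a x = b;
  dg_solve_l : forall a b, a \in B -> b \in B ->
    exists! y, y \in B /\ op y a = b;
  dg_distr_r : forall a b c, a \in B -> b \in B -> c \in B ->
    op (op a b) c = op (op a c) (op b c);
  dg_distr_l : forall a b c, a \in B -> b \in B -> c \in B ->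
    op c (op a b) = op (op c a) (op c b)
}.

Definition distributive_group : Prop := distributive_group_on [set: G].

Definition subgroup (B : {set G}) : Prop := distributive_group_on B.

Definition simple_subgroup (A : {set G}) : Prop :=
  subgroup A /\
  forall B : {set G}, subgroup B -> B \proper A -> ~ (1 < #|B|).

Definition set_op (X Y : {set G}) : {set G} := [set op x y | x in X, y in Y].

Definition set_op_elt (X : {set G}) (p : G) : {set G} := [set op x p | x in X].

Definition distinguished : Prop :=
  distributive_group /\
  forall (B : {set G}) (p : G), subgroup B ->
    (subgroup (set_op B (set_op_elt B p)) /\
     #|set_op B (set_op_elt B p)| = #|B|) /\
    (subgroup (set_op (set_op_elt B p) B) /\
     #|set_op (set_op_elt B p) B| = #|B|).

Definition Hset (A : {set G}) (p q : G) : {set G} :=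
  set_op (set_op_elt A p) (set_op_elt A q).

End DistributiveGroups.

Definition pairwise_disjoint (G I : finType) (F : I -> {set G}) : Prop :=
  forall i j : I, i != j -> [disjoint F i & F j].

(* Main.v *)
Require Import Defs.
From mathcomp Require Import all_boot.

(** The first decomposition only spells out [Hset]. For the second one, write
    $q = a_1 . u$. The set $A.(A.u)$ contains every coset $A.(b.u)$ and every
    left translate $b.(A.u)$ with $b \in A$; all of these have $|A|$ elements,
    and so has $A.(A.u)$, because $G$ is distinguished. Hence they are all
    equal, in particular $A.q = A.(A.u) = b.(A.u)$ for every $b \in A$
    ([absorb_right_coset], [absorb_left_translate]).

    So, for a fixed left factor $b.p$ of an element of $(A.p).(A.q)$, the right
    factor may be written with the same $b$ in front: it runs through the
    elements $b.(a_i.u)$. Left distributivity gives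
    $(b.p).(b.(a_i.u)) = b.(p.(a_i.u))$, so that $(A.p).(A.q)$ is the union of
    the cosets $A.\tau_i$ with $\tau_i = p.(a_i.u)$, and $\tau_1 = p.q$.

    Disjointness is counting: translations are injective, so each decomposition
    consists of $v$ sets of $v$ elements, and a union which has as many
    elements as its members have together is disjoint
    ([card_bigcup_eq_disjoint]). *)

Lemma card_bigcup_le_sum (T I : finType) (P : pred I) (F : I -> {set T}) :
  #|\bigcup_(i | P i) F i| <= \sum_(i | P i) #|F i|.
Proof.
elim/big_rec2: _ => [|i n B _ leBn]; first by rewrite cards0.
by apply: leq_trans (leq_card_setU _ _) _; rewrite leq_add2l.
Qed.

Lemma card_bigcup_eq_disjoint (T I : finType) (F : I -> {set T}) :
  #|\bigcup_i F i| = \sum_i #|F i| -> pairwise_disjoint F.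
Proof.
move=> eq_card i j neq_ij.
set R := \bigcup_(k | k != i) F k.
have sFjR : F j \subset R by apply: bigcup_sup; rewrite eq_sym.
suff dFiR : [disjoint F i & R] by apply: disjointWr sFjR dFiR.
have defU : F i :|: R = \bigcup_k F k by rewrite [RHS](bigD1 i).
rewrite -(leq_card_setU (F i) R) eqn_leq leq_card_setU defU eq_card.
by rewrite (bigD1 i) //= leq_add2l card_bigcup_le_sum.
Qed.

Section DistinguishedGroup.

Set Implicit Arguments.
Unset Strict Implicit.

Variables (G : finType) (op : G -> G -> G).

Lemma op_left_inj (a : G) : distributive_group op -> injective (op a).
Proof.
move=> dG x y eq_xy.
have [z [_ uniq_z]] := dg_solve_r dG (in_setT a) (in_setT (op a x)).
by rewrite -(uniq_z x) ?in_setT // -(uniq_z y) ?in_setT.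
Qed.

Lemma op_right_inj (p : G) : distributive_group op -> injective (op^~ p).
Proof.
move=> dG x y eq_xy.
have [z [_ uniq_z]] := dg_solve_l dG (in_setT p) (in_setT (op x p)).
by rewrite -(uniq_z x) ?in_setT // -(uniq_z y) ?in_setT.
Qed.

Lemma card_set_op_elt (X : {set G}) (p : G) :
  distributive_group op -> #|set_op_elt op X p| = #|X|.
Proof. by move=> dG; apply: card_imset; apply: op_right_inj. Qed.

(** The coset of $b.u$ lies in $B.(B.u)$, which has just as many elements. *)
Lemma absorb_right_coset (B : {set G}) (b u : G) :
    distinguished op -> subgroup op B -> b \in B ->
  set_op_elt op B (op b u) = set_op op B (set_op_elt op B u).
Proof.
move=> [dG distG] sB Bb; apply/eqP; rewrite eqEcard card_set_op_elt //.
have [[_ ->] _] := distG B u sB; rewrite leqnn andbT.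
by apply/subsetP=> _ /imsetP[c Bc ->]; apply: imset2_f => //; apply: imset_f.
Qed.

(** Same count as for cosets; this is what allows the left factor $b$ to be
    prescribed in a product from $B.(B.u)$. *)
Lemma absorb_left_translate (B : {set G}) (b u : G) :
    distinguished op -> subgroup op B -> b \in B ->
  op b @: set_op_elt op B u = set_op op B (set_op_elt op B u).
Proof.
move=> [dG distG] sB Bb; apply/eqP; rewrite eqEcard.
rewrite (card_imset _ (@op_left_inj b dG)) card_set_op_elt //.
have [[_ ->] _] := distG B u sB; rewrite leqnn andbT.
by apply/subsetP=> _ /imsetP[c Bc ->]; apply: imset2_f.
Qed.

Lemma Hset_right_translates (A : {set G}) (p q : G) :
  Hset op A p q =
    \bigcup_(b in A) set_op_elt op (set_op_elt op A p) (op b q).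
Proof.
apply/setP=> x; apply/imset2P/bigcupP.
  move=> [y _ Apy /imsetP[b Ab ->] ->]; exists b => //; exact: imset_f.
by move=> [b Ab /imsetP[y Apy ->]]; exists y (op b q) => //; apply: imset_f.
Qed.

Lemma Hset_left_cosets (A : {set G}) (p b u : G) :
    distinguished op -> subgroup op A -> b \in A ->
  Hset op A p (op b u) = \bigcup_(c in A) set_op_elt op A (op p (op c u)).
Proof.
move=> hG sA Ab; rewrite /Hset absorb_right_coset //.
have distl c x y : op c (op x y) = op (op c x) (op c y).
  by case: hG => dG _; apply: (dg_distr_l dG); rewrite in_setT.
apply/setP=> x; apply/imset2P/bigcupP.
  move=> [_ w /imsetP[d Ad ->] + ->].
  rewrite -(absorb_left_translate u hG sA Ad) => /imsetP[_ /imsetP[c Ac ->] ->].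
  by exists c => //; rewrite -distl; apply: imset_f.
move=> [c Ac /imsetP[d Ad ->]].
exists (op d p) (op d (op c u)); last exact: distl; first exact: imset_f.
by apply: imset2_f => //; apply: imset_f.
Qed.

End DistinguishedGroup.

Theorem theorem5p7 (G : finType) (op : G -> G -> G)
    (hG : distinguished op)
    (A : {set G}) (hA : simple_subgroup op A)
    (v : nat) (hv : #|A| = v)
    (a : 'I_v -> G) (ha : A = [set a i | i : 'I_v])
    (p q : G) :
  Hset op A p q
    = \bigcup_(i < v) set_op_elt op (set_op_elt op A p) (op (a i) q) /\
  exists tau : 'I_v -> G,
    [/\ exists2 i1 : 'I_v, i1 = 0 :> nat & tau i1 = op p q,
        Hset op A p q = \bigcup_(i < v) set_op_elt op A (tau i)
      & #|Hset op A p q| = v ^ 2 ->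
        pairwise_disjoint
          (fun i => set_op_elt op (set_op_elt op A p) (op (a i) q)) /\
        pairwise_disjoint (fun i => set_op_elt op A (tau i))].
Proof.
have [[dG _] [sA _]] := (hG, hA).
have Aa i : a i \in A by rewrite ha imset_f.
have bigcup_a (F : G -> {set G}) : \bigcup_(b in A) F b = \bigcup_i F (a i).
  apply/setP=> x; apply/bigcupP/bigcupP => [[b]|[i _ Fx]]; last by exists (a i).
  by rewrite ha => /imsetP[i _ ->] Fx; exists i.
have v_gt0 : 0 < v by rewrite -hv card_gt0 (dg_nonempty sA).
pose i1 := Ordinal v_gt0.
have [u [[_ def_q] _]] := dg_solve_r dG (in_setT (a i1)) (in_setT q).
have Hright := Hset_right_translates op A p q; rewrite bigcup_a in Hright.
have Hleft := Hset_left_cosets p u hG sA (Aa i1).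
rewrite def_q bigcup_a in Hleft.
split=> //; exists (fun i => op p (op (a i) u)); split=> //.
  by exists i1; rewrite ?def_q.
have card_cosets (F : 'I_v -> {set G}) : (forall i, #|F i| = v) ->
    Hset op A p q = \bigcup_i F i -> #|Hset op A p q| = v ^ 2 ->
    pairwise_disjoint F.
  move=> cardF -> cardH; apply: card_bigcup_eq_disjoint.
  by rewrite cardH (eq_bigr (fun=> v)) // sum_nat_const card_ord mulnn.
by move=> cardH; split; apply: card_cosets => // i; rewrite !card_set_op_elt.
Qed.
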